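(* Let $X=\{X_n\}$ and $Y=\{Y_n\}$ be stationary processes, independent of each other, with values in $A$ and $\hat A$ respectively. Assume that $\rho$ is bounded and that, for $\mathbb P$-almost every realization $x_1^\infty$ of $X_1^\infty$, conditional on $X_1^\infty=x_1^\infty$, the random variables $\{\rho_n(x_1^n,Y_1^n): n\ge1\}$ satisfy a large deviations principle with some deterministic (not depending on $x_1^\infty$), convex rate-function. Then for every $D\in(D_{\rm min},D_{\rm av})$, except possibly at the point $D=D_{\rm min}^{(\infty)}$, the limit $$R(\mathbb P,\mathbb Q,D)=\lim_{n\to\infty}R_n(P_n,Q_n,D)$$ exists, and $$-\frac1n\log Q_n(B(X_1^n,D))\to R(\mathbb P,\mathbb Q,D)\quad\text{with probability one.}$$ Here $$R_n(P_n,Q_n,D)=\inf_{V_n}\frac1n H(V_n\|P_n\times Q_n),$$ where the infimum is over all joint probability distributions $V_n$ on $A^n\times\hat A^n$ whose $A^n$-marginal is $P_n$ and which satisfy $E_{V_n}[\rho_n(X_1^n,Y_1^n)]\le D$, and $$D_{\rm min}^{(\infty)}=\inf\Big\{D\ge0:\sup_{n\ge1}R_n(P_n,Q_n,D)<\infty\Big\}.$$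
   Context: $A$ and $\hat A$ are complete separable metric spaces with their Borel $\sigma$-fields. $\mathbb P,\mathbb Q$ are the distributions of the processes $X,Y$; $P_n,Q_n$ are the distributions of $X_1^n=(X_1,\dots,X_n)$ and $Y_1^n=(Y_1,\dots,Y_n)$. $\rho:A\times\hat A\to[0,\infty)$ is measurable, $\rho_n(x_1^n,y_1^n)=\frac1n\sum_{i=1}^n\rho(x_i,y_i)$, and $B(x_1^n,D)=\{y_1^n\in\hat A^n:\rho_n(x_1^n,y_1^n)\le D\}$. $D_{\rm av}=E_{P_1\times Q_1}[\rho(X_1,Y_1)]$, $D_{\rm min}^{(n)}=E_{P_n}[\operatorname{ess\,inf}_{Y_1^n\sim Q_n}\rho_n(X_1^n,Y_1^n)]$ (essential infimum with respect to $Q_n$ with $X_1^n$ fixed), and $D_{\rm min}=\lim_{n\to\infty}D_{\rm min}^{(n)}=\sup_{n\ge1}D_{\rm min}^{(n)}$. It is assumed that $D_{\rm min}<D_{\rm av}$. $\log$ is natural, with $-\log 0=+\infty$; the limits may equal $+\infty$. $H(W\|V)=E_W[\log\frac{dW}{dV}]$ if the density exists, and $\infty$ otherwise. Large deviations principle: real random variables $Z_n$ satisfy the LDP (speed $n$) with rate-function $I:\mathbb R\to[0,\infty]$, $I$ lower semicontinuous, if for every Borel $\Gamma\subset\mathbb R$, $-\inf_{\Gamma^\circ}I\le\liminf_n\frac1n\log\Pr\{Z_n\in\Gamma\}\le\limsup_n\frac1n\log\Pr\{Z_n\in\Gamma\}\le-\inf_{\overline\Gamma}I$. *)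

(* Defs.v *)
From HB Require Import structures.
From mathcomp Require Import all_boot all_order all_algebra.
From mathcomp Require Import all_classical all_reals all_analysis.
From mathcomp Require Import ess_sup_inf.

Set Implicit Arguments.
Unset Strict Implicit.
Unset Printing Implicit Defensive.

Import Order.TTheory GRing.Theory Num.Theory.
Import numFieldNormedType.Exports.

Local Open Scope classical_set_scope.
Local Open Scope ring_scope.
Local Open Scope charge_scope.
Local Open Scope ereal_scope.

#[short(type="completeMetricType")]
HB.structure Definition CompleteMetric (K : numDomainType) :=
  {M of CompletePseudoMetric K M & Metric K M}.

Definition separable (T : topologicalType) : Prop :=
  exists2 S : set T, countable S & dense S.

Notation borel_algebra T := (g_sigma_algebraType (@open T)).

Definition cylinders d (T : measurableType d) : set (set (nat -> T)) :=
  \bigcup_(i in [set: nat]) preimage_set_system setT (fun x => x i) measurable.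

(* One-sided infinite sequences with the product sigma-algebra. The index is
   shifted: x_1, x_2, ... are x 0, x 1, ... *)
Notation path_space T := (g_sigma_algebraType (@cylinders _ T)).

Section processes.
Context d (T : measurableType d).

Definition first_n n (x : path_space T) : n.-tuple T := [tuple x i | i < n].

Context d' (Omega : measurableType d') (R : realType) (Pr : probability Omega R).
Implicit Type X : nat -> {RV Pr >-> T}.

Definition trajectory X (w : Omega) : path_space T := fun i => X i w.

Lemma measurable_trajectory X : measurable_fun [set: Omega] (trajectory X).
Proof.
apply: (@measurability _ _ _ (path_space T) _ _ (@cylinders d T) erefl).
by move=> _ [_ [i _ [B mB <-]] <-]; rewrite !setTI; apply: measurable_funPTI.
Qed.

HB.instance Definition _ X :=
  isMeasurableFun.Build _ _ _ _ (trajectory X) (@measurable_trajectory X).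

Definition block X n (w : Omega) : n.-tuple T := first_n n (trajectory X w).

Lemma measurable_block X n : measurable_fun [set: Omega] (block X n).
Proof.
apply/measurable_fun_tnthP => i.
rewrite (_ : _ \o _ = X i); last by apply/funext => w /=; rewrite tnth_mktuple.
exact: measurable_funPT.
Qed.

HB.instance Definition _ X n :=
  isMeasurableFun.Build _ _ _ _ (block X n) (@measurable_block X n).

(* Distribution of X_1^n. *)
Definition block_law X n : probability (n.-tuple T) R :=
  distribution Pr (block X n).

Definition process_law X : probability (path_space T) R :=
  distribution Pr (trajectory X).

Definition stationary X : Prop :=
  forall (k n : nat) (B : set (n.-tuple T)), measurable B ->
    block_law (fun i => X (k + i)%N) n B = block_law X n B.

End processes.

Section two_processes.
Context d1 (T1 : measurableType d1) d2 (T2 : measurableType d2).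
Context d (Omega : measurableType d) (R : realType) (Pr : probability Omega R).
Variables (X : nat -> {RV Pr >-> T1}) (Y : nat -> {RV Pr >-> T2}).

Definition independent_processes : Prop :=
  forall (B : set (path_space T1)) (C : set (path_space T2)),
    measurable B -> measurable C ->
    Pr (trajectory X @^-1` B `&` trajectory Y @^-1` C) =
    Pr (trajectory X @^-1` B) * Pr (trajectory Y @^-1` C).

(* kappa is a regular version of the conditional distribution of Y given X. *)
Definition conditional_law
    (kappa : R.-pker (path_space T1) ~> (path_space T2)) : Prop :=
  forall (B : set (path_space T1)) (C : set (path_space T2)),
    measurable B -> measurable C ->
    Pr (trajectory X @^-1` B `&` trajectory Y @^-1` C) =
    \int[process_law X]_(x in B) kappa x C.

End two_processes.

Section large_deviations.
Context (R : realType).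

Definition econvex (I : R -> \bar R) : Prop :=
  forall (x y t : R), (0 <= t <= 1)%R ->
    I (t * x + (1 - t) * y)%R <= t%:E * I x + (1 - t)%:E * I y.

(* Speed n; the term n = 0 of the sequences is irrelevant to the limits. *)
Definition LDP d (T : measurableType d) (mu : {measure set T -> \bar R})
    (Z : nat -> T -> R) (I : R -> \bar R) : Prop :=
  [/\ forall x, 0 <= I x, lower_semicontinuous I &
    forall G : set R, measurable G ->
      let l n := n%:R^-1%:E * lne (mu (Z n @^-1` G)) in
      [/\ - ereal_inf [set I x | x in interior G] <= limn_einf l,
          limn_einf l <= limn_esup l &
          limn_esup l <= - ereal_inf [set I x | x in closure G]]].

(* By Radon-Nikodym, W `<< V is the existence of the density dW/dV. *)
Definition relative_entropy d (T : measurableType d) (W V : probability T R)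
    : \bar R :=
  if pselect (W `<< V) is left _
  then \int[W]_x lne ('d (charge_of_finite_measure W) '/d V x)
  else +oo.

End large_deviations.

Section distortion.
Context d1 (A : measurableType d1) d2 (B : measurableType d2) (R : realType).
Variable rho : A -> B -> R.

Definition rho_n n (x : n.-tuple A) (y : n.-tuple B) : R :=
  (n%:R^-1 * \sum_(i < n) rho (tnth x i) (tnth y i))%R.

Definition distortion_ball n (x : n.-tuple A) (D : R) : set (n.-tuple B) :=
  [set y | (rho_n x y <= D)%R].

Definition R_n n (Pn : probability (n.-tuple A) R)
    (Qn : probability (n.-tuple B) R) (D : R) : \bar R :=
  ereal_inf [set n%:R^-1%:E * relative_entropy V (Pn \x Qn) | V in
    [set V : probability (n.-tuple A * n.-tuple B)%type R |
      (forall C, measurable C -> V (C `*` setT) = Pn C) /\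
      \int[V]_z (rho_n z.1 z.2)%:E <= D%:E]].

Context d (Omega : measurableType d) (Pr : probability Omega R).
Variables (X : nat -> {RV Pr >-> A}) (Y : nat -> {RV Pr >-> B}).

Definition D_av : \bar R :=
  \int[distribution Pr (X 0%N) \x distribution Pr (Y 0%N)]_z (rho z.1 z.2)%:E.

Definition D_min_n n : \bar R :=
  \int[block_law X n]_x ess_inf (block_law Y n) (fun y => (rho_n x y)%:E).

(* For stationary processes this supremum is also the limit of D_min_n. *)
Definition D_min : \bar R := ereal_sup [set D_min_n n | n in [set n | (0 < n)%N]].

Definition D_min_infty : \bar R :=
  ereal_inf [set D%:E | D in [set D : R | (0 <= D)%R /\
    ereal_sup [set R_n (block_law X n) (block_law Y n) D |
               n in [set n | (0 < n)%N]] < +oo]].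

Definition R_rate (D : R) : \bar R :=
  limn (fun n => R_n (block_law X n) (block_law Y n) D).

End distortion.

(* Main.v *)
Require Import Defs.
From HB Require Import structures.
From mathcomp Require Import all_boot all_order all_algebra.
From mathcomp Require Import all_classical all_reals all_analysis.
From mathcomp Require Import measurable_realfun ess_sup_inf.
From mathcomp Require Import ring lra.

(** The rate function [I] enters only through the sublevel sets of the
    distortion, that is through [lower_rate I D], the infimum of [I] over
    [z <= D].

    Independence makes the conditional law of the second process equal to its
    own law on every ball event, almost surely ([conditional_ball_mass]).  The
    large deviations principle then reads, for almost every path [x] and every
    level [a]: the exponential rate of the [Q_n]-mass of the ball of radius [a]
    around [x] has all its limit points between the infimum of [I] over
    [z <= a] and the infimum over [z < a] ([ball_rate_ldp]).  By convexity both
    infima agree at [D], unless [D] is the left end of the domain of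
    [lower_rate I]; this is [rate_regular], and gives the almost sure limit of
    the ball rates ([ball_rate_cvg]).

    The same value is the limit of [R_n].

    Upper bound ([R_n_near_le]): choose a radius [a < D] at which the rate is
    already below [c].  Let the second block be drawn from [Q_n] conditioned on
    the ball of radius [a] around the first block, except for the blocks [x] at
    which that ball has mass less than [exp(-n c)], where it is drawn from
    [Q_n] itself.  The density is at most [exp(n c)], so the normalized
    relative entropy is at most [c]; the exceptional [x] have probability
    tending to [0] and the distortion is bounded by [M], so they raise the mean
    distortion by at most [D - a].

    Lower bound ([R_n_near_ge]): take a line of slope [lam <= 0] below [I].
    Cutting [0, M] into small cells bounds the exponential moment of
    [n lam rho_n(x, _)] by a sum of ball masses, so for almost every [x] it
    is eventually at most the value that the line predicts, up to a factor
    [exp(n eps)] ([exp_moment_ldp]).  The Gibbs variational inequality, applied to this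
    exponential tilt on the good [x] only, bounds every competing relative
    entropy from below ([R_n_ge]).  Lines below [I] come as close to
    [lower_rate I D] at [D] as desired ([supporting_line]).

    Finally, if [D > D_min] is the left end of the domain of [lower_rate I],
    then [D] is [D_min_infty]: below [D] the [R_n] tend to infinity, and above
    [D] they are eventually bounded, and each of them is finite because the
    mean essential infimum of the distortion is below [D] ([R_n_lty]). *)
Import Order.TTheory GRing.Theory Num.Theory.
Import numFieldNormedType.Exports.
Set Implicit Arguments.
Unset Strict Implicit.
Unset Printing Implicit Defensive.
Local Open Scope classical_set_scope.
Local Open Scope ring_scope.
Local Open Scope charge_scope.
Local Open Scope ereal_scope.

(** * Limits and bounds in the extended reals *)

Section real_sequences.
Context (R : realType).
Implicit Types (u : (\bar R)^nat) (t l : \bar R).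

Lemma limn_esup_lt_near u t :
  limn_esup u < t -> \forall n \near \oo, u n < t.
Proof.
rewrite limn_esup_lim (cvg_lim _ (@cvg_esups_inf R u))//.
move=> /ereal_inf_lt[_ [N _ <-]] uN; exists N => // n Nn /=.
by apply: le_lt_trans uN; apply: ereal_sup_ubound; exists n.
Qed.

Lemma limn_einf_gt_near u t :
  t < limn_einf u -> \forall n \near \oo, t < u n.
Proof.
rewrite /limn_einf lteNr => /limn_esup_lt_near; apply: filterS => n /=.
by rewrite lteN2.
Qed.

(** Squeezing by real bounds only: it treats finite and infinite limits
    alike, and each bound may hold from its own rank on. *)
Lemma cvge_between u l :
  (forall c : R, c%:E < l -> \forall n \near \oo, c%:E <= u n) ->
  (forall c : R, l < c%:E -> \forall n \near \oo, u n <= c%:E) ->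
  u @ \oo --> l.
Proof.
case: l => [l| |] lo up.
- have H (e : R) : (0 < e)%R ->
      \forall n \near \oo, (l - e)%:E <= u n <= (l + e)%:E.
    move=> e0; have := lo (l - e)%R; have := up (l + e)%R.
    rewrite !lte_fin ltrDl gtrBl => /(_ e0) h1 /(_ e0).
    by apply: filterS2 h1 => n -> ->.
  apply/fine_cvgP; split.
    apply: filterS (H 1%R ltr01) => n /andP[h1 h2].
    by rewrite fin_numElt (lt_le_trans _ h1) ?ltNyr//= (le_lt_trans h2)// ltry.
  apply/cvgrPdist_le => e e0; apply: filterS (H e e0) => n /=.
  case: (u n) => [r| |]; rewrite ?leye_eq ?leeNy_eq ?andbF// !lee_fin.
  move=> /andP[h1 h2]; rewrite /= ler_norml; apply/andP; split; lra.
- by apply/cvgeyPge => c; apply: lo; rewrite ltry.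
- by apply/cvgeNyPle => c; apply: up; rewrite ltNyr.
Qed.

Lemma ereal_sup_lty u (c : R) : (forall n, (0 < n)%N -> u n < +oo) ->
  (\forall n \near \oo, u n <= c%:E) ->
  ereal_sup [set u n | n in [set n | (0 < n)%N]] < +oo.
Proof.
move=> ufin [N _ uN].
have [C uC] : exists C : R, forall n, (0 < n < N)%N -> u n <= C%:E.
  elim: N {uN} => [|N [C uC]]; first by exists 0%R => n; rewrite ltn0 andbF.
  have [->|N0] := posnP N; first by exists 0%R => -[].
  have [C' uC'] : exists C' : R, u N <= C'%:E.
    case: (u N) (ufin N N0) => [r _|//|_]; first by exists r.
    by exists 0%R; rewrite leNye.
  exists (Num.max C C') => n /andP[n0]; rewrite ltnS leq_eqVlt => /predU1P[->|nN].
    by rewrite (le_trans uC')// lee_fin le_max lexx orbT.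
  by rewrite (le_trans (uC n _)) ?n0// lee_fin le_max lexx.
apply: (@le_lt_trans _ _ (Num.max c C)%:E); last exact: ltry.
apply: ge_ereal_sup => _ /= [n n0 <-]; have [Nn|nN] := leqP N n.
  by rewrite (le_trans (uN n Nn))// lee_fin le_max lexx.
by rewrite (le_trans (uC n _)) ?n0// lee_fin le_max lexx orbT.
Qed.

Lemma grid_cell (a : nat -> R) K (v : R) : (a 0%N <= v)%R -> (v <= a K)%R ->
  (0 < K)%N -> exists2 k : 'I_K, (a k <= v)%R & (v <= a k.+1)%R.
Proof.
move=> a0; elim: K => // K IH vK _; have [av|va] := leP (a K) v.
  by exists ord_max.
case: K IH vK va => [|K] IH vK va; first by move: va; rewrite ltNge a0.
have [k ak vk] := IH (ltW va) isT.
by exists (widen_ord (leqnSn _) k).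
Qed.

Lemma lt_between (c : R) (l : \bar R) : c%:E < l ->
  exists2 c' : R, (c < c')%R & c'%:E < l.
Proof.
case: l => [l| |]//; rewrite ?lte_fin => cl.
  by exists ((c + l) / 2)%R; rewrite ?lte_fin; lra.
by exists (c + 1)%R; rewrite ?ltry//; lra.
Qed.

(** The [+ 1] avoids a division by zero when [M = 0]. *)
Lemma lee_mul_small (M e : R) (p : \bar R) : 0 <= p -> (0 < e)%R ->
  p <= (e / (`|M| + 1))%:E -> M%:E * p <= e%:E.
Proof.
move=> p0 e0 pe; apply: (@le_trans _ _ (`|M|%:E * p)).
  by rewrite lee_wpmul2r// lee_fin ler_norm.
apply: le_trans (lee_wpmul2l _ pe) _; first by rewrite lee_fin.
rewrite -EFinM lee_fin mulrCA ger_pMr// ler_pdivrMr ?ltr_wpDl//.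
by rewrite mul1r lerDl.
Qed.

End real_sequences.

(** * Convex rate functions *)

Section lower_rate.
Context (R : realType) (I : R -> \bar R).

Definition lower_rate (a : R) : \bar R :=
  ereal_inf [set I z | z in [set z | (z <= a)%R]].

Hypotheses (I_ge0 : forall z, 0 <= I z) (I_convex : econvex I).

(** [D] is not the left end of the domain of [lower_rate]. *)
Definition rate_regular (D : R) :=
  (exists2 z, (z < D)%R & I z < +oo) \/
  (exists2 D', (D < D')%R & forall z, (z <= D')%R -> I z = +oo).

Let Ifin z : I z < +oo -> I z = (fine (I z))%:E.
Proof. by move=> Iz; rewrite fineK// ge0_fin_numE. Qed.

(** To the left of the domain a steep line through [(D, c)] drops below [0]
    before the rate can be finite.  Inside the domain, the slope is the
    supremum of the slopes of the chords that join [(D, c)] to the points of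
    the graph at the left of [D]; convexity keeps the line below the rate at the right of [D]. *)
Lemma supporting_line (D c : R) : rate_regular D -> c%:E < lower_rate D ->
  exists2 lam, (lam <= 0)%R & forall z, (c + lam * (z - D))%:E <= I z.
Proof.
move=> regD cD.
have cI z : (z <= D)%R -> c%:E <= I z.
  by move=> zD; apply/ltW/(lt_le_trans cD); apply: ereal_inf_lbound; exists z.
case: regD => [[z0 z0D Iz0]|[D' DD' ID']].
  pose r z := ((fine (I z) - c) / (D - z))%R.
  pose S := [set r z | z in [set z | (z < D)%R /\ I z < +oo]].
  have r0 z : (z < D)%R -> I z < +oo -> (0 <= r z)%R.
    move=> zD /Ifin Iz; rewrite divr_ge0 ?subr_ge0// ?(ltW zD)//.
    by rewrite -lee_fin -Iz cI// ltW.
  have S0 : lbound S 0%R by move=> _ [z [zD Iz] <-]; exact: r0.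
  have Sn : S !=set0 by exists (r z0); exists z0.
  have infS z : (z < D)%R -> I z < +oo -> (inf S <= r z)%R.
    by move=> zD Iz; apply: ge_inf; [exists 0%R|exists z].
  (* [r z] is minus the slope of the chord from (D, c) to (z, I z). *)
  exists (- inf S)%R; first by rewrite oppr_le0; exact: lb_le_inf.
  move=> z; have [->|Izoo] := eqVneq (I z) +oo; first by rewrite leey.
  have {Izoo} Iz : I z < +oo by rewrite ltey.
  have [zD|Dz|->] := ltgtP z D; last by rewrite subrr mulr0 addr0 cI.
    have := infS z zD Iz; rewrite /r ler_pdivlMr ?subr_gt0// (Ifin Iz) lee_fin.
    by lra.
  rewrite (Ifin Iz) lee_fin.
  suff : ((c - fine (I z)) / (z - D) <= inf S)%R.
    by rewrite ler_pdivrMr ?subr_gt0//; lra.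
  apply: lb_le_inf => // _ [z' [z'D Iz'] <-].
  rewrite /r ler_pdivrMr ?subr_gt0// mulrAC ler_pdivlMr ?subr_gt0//.
  (* [D] as a convex combination of [z' < D < z] *)
  pose t := ((z - D) / (z - z'))%R.
  have zz' : (0 < z - z')%R by lra.
  have t01 : (0 <= t <= 1)%R.
    by rewrite /t divr_ge0 ?ler_pdivrMr//=; lra.
  have tz : (t * (z - z') = z - D)%R by rewrite /t divfK// gt_eqF.
  have := @I_convex z' z t t01.
  rewrite (_ : (t * z' + (1 - t) * z)%R = D); last by lra.
  move/(le_trans (cI D (lexx _))).
  rewrite (Ifin Iz) (Ifin Iz') -!EFinM -EFinD lee_fin.
  set i' := fine (I z'); set i := fine (I z) => h.
  have : (c * (z - z') <= (t * i' + (1 - t) * i) * (z - z'))%R.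
    by rewrite ler_wpM2r// ltW.
  rewrite (_ : ((t * i' + (1 - t) * i) * (z - z') =
      (t * (z - z')) * i' + ((z - z') - t * (z - z')) * i)%R); last by ring.
  by rewrite tz /=; lra.
pose L := Num.max c 0%R.
have L0 : (0 <= L)%R by rewrite le_max lexx orbT.
have cL : (c <= L)%R by rewrite le_max lexx.
have D'D : (0 < D' - D)%R by rewrite subr_gt0.
(* the slope of the line through (D, L) and (D', 0) *)
exists (- (L / (D' - D)))%R; first by rewrite oppr_le0 divr_ge0// ltW.
move=> z; have [zD'|D'z] := leP z D'; first by rewrite ID'// leey.
apply: le_trans (I_ge0 z); rewrite lee_fin.
have : (L <= L / (D' - D) * (z - D))%R.
  by rewrite mulrAC ler_pdivlMr// ler_wpM2l//; lra.
by lra.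
Qed.

(** Left continuity of [lower_rate] at [D].  When the infimum below [c] is
    attained at [D] itself, move from [D] slightly towards a point of the
    domain; convexity makes the rate vary little. *)
Lemma lower_rate_left (D c : R) : rate_regular D -> lower_rate D < c%:E ->
  exists2 z, (z < D)%R & I z < c%:E.
Proof.
move=> [[z0 z0D Iz0]|[D' DD' ID']]; last first.
  move=> /ereal_inf_lt[_ [z /= zD <-]].
  by rewrite ID'// (le_trans zD)// ltW.
move=> /ereal_inf_lt[_ [z /= zD <-]] Izc.
have [zD'|Dz] := ltP z D; first by exists z.
have zE : z = D by apply/eqP; rewrite eq_le zD.
rewrite {}zE in Izc.
have ID : I D < +oo by rewrite (lt_trans Izc)// ltry.
move: (Izc); rewrite (Ifin ID) lte_fin.
set i := fine (I D); set i0 := fine (I z0) => ic.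
(* small enough that [t * (i0 - i) < c - i], and never zero *)
pose t := ((c - i) / (c - i + `|i0 - i|))%R.
have d0 : (0 < c - i + `|i0 - i|)%R by rewrite ltr_wpDr// subr_gt0.
have t0 : (0 < t)%R by rewrite divr_gt0// subr_gt0.
have t1 : (t <= 1)%R by rewrite ler_pdivrMr// mul1r lerDl.
exists (t * z0 + (1 - t) * D)%R.
  have : (0 < t * (D - z0))%R by rewrite mulr_gt0// subr_gt0.
  by lra.
have := @I_convex z0 D t; rewrite (ltW t0) t1 => /(_ isT) /le_lt_trans; apply.
rewrite (Ifin ID) (Ifin Iz0) -!EFinM -EFinD lte_fin -/i -/i0.
have : (t * (c - i + `|i0 - i|) = c - i)%R by rewrite /t divfK// gt_eqF.
have : (t * (i0 - i) <= t * `|i0 - i|)%R by rewrite ler_wpM2l ?ler_norm// ltW.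
have : (0 < t * (c - i))%R by rewrite mulr_gt0// subr_gt0.
by lra.
Qed.

End lower_rate.

(** * Measures and densities *)

Section density.
Context d (T : measurableType d) (R : realType).
Variables (mu : {measure set T -> \bar R}) (f : T -> \bar R).
Hypotheses (mf : measurable_fun setT f) (f0 : forall x, 0 <= f x).

(** The two proofs are arguments of the set function so that the measure
    structure below can be inferred from the term. *)
Definition density (mf : measurable_fun setT f) (f0 : forall x, 0 <= f x)
  (E : set T) : \bar R := \int[mu]_(x in E) f x.

Let density0 : density mf f0 set0 = 0.
Proof. exact: integral_set0. Qed.

Let density_ge0 E : 0 <= density mf f0 E.
Proof. exact: integral_ge0. Qed.

Let density_sigma_additive : semi_sigma_additive (density mf f0).
Proof.
move=> F mF tF mUF; rewrite /density ge0_integral_bigcup//.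
  apply/cvg_closeP; split; last by rewrite closeE.
  by apply: is_cvg_nneseries => n _ _; exact: integral_ge0.
exact: measurable_funTS.
Qed.

HB.instance Definition _ := isMeasure.Build _ _ _ (density mf f0)
  density0 density_ge0 density_sigma_additive.

Hypothesis f1 : \int[mu]_x f x = 1.

HB.instance Definition _ := Measure_isProbability.Build _ _ _
  (density mf f0) f1.

Lemma probability_of_density :
  exists V : probability T R, forall E, V E = \int[mu]_(x in E) f x.
Proof. by exists (density mf f0 : probability T R). Qed.

End density.

Lemma measurable_lne (R : realType) :
  measurable_fun [set: \bar R] (@lne R).
Proof.
rewrite (_ : @lne R = fun x : \bar R => if x <= 0 then -oo else
   if x == +oo then +oo else (ln (fine x))%:E); last first.
  by apply/funext => -[r| |]//=; rewrite ?leye_eq ?leNye.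
apply: measurable_fun_ifT => //.
  exact: measurable_fun_lee.
apply: measurable_fun_ifT => //.
- apply: (measurable_fun_bool true) => /=.
  rewrite setTI (_ : _ @^-1` _ = [set +oo]); first exact: emeasurable_set1.
  by apply/seteqP; split => x /= /eqP.
- apply/measurable_EFinP; apply: measurableT_comp => //.
Qed.

Section almost_everywhere.
Context d (T : measurableType d) (R : realType).
Implicit Types mu : {measure set T -> \bar R}.

(** It also covers infinite integrals, such as infinite relative entropies. *)
Lemma ae_le_integral mu (f g : T -> \bar R) :
  measurable_fun setT f -> measurable_fun setT g ->
  {ae mu, forall x, f x <= g x} -> \int[mu]_x f x <= \int[mu]_x g x.
Proof.
move=> mf mg fg; rewrite integralE [leRHS]integralE leeB//;
    (apply: ae_ge0_le_integral => //;
      [exact: measurable_funepos || exact: measurable_funeneg..|]).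
- apply: filterS fg => x fgx _.
  by rewrite !funeposE ge_max le_max fgx/= le_max lexx orbT.
- apply: filterS fg => x fgx _.
  by rewrite !funenegE ge_max !le_max leeN2 fgx/= lexx orbT.
Qed.

(** The upper limit of the [B n] is negligible, and the measures of the unions of
    the tails decrease to its measure. *)
Lemma measure_eventually0 (P : probability T R) (B : (set T)^nat) :
  (forall n, measurable (B n)) ->
  {ae P, forall x, \forall n \near \oo, ~ B n x} ->
  P (B n) @[n --> \oo] --> 0.
Proof.
move=> mB aeB.
have L0 : P (lim_sup_set B) = 0.
  have mL : measurable (lim_sup_set B).
    by apply: bigcap_measurable => // n _; apply: bigcup_measurable.
  apply/eqP; rewrite -measure_le0; have [N [mN <- subN]] := aeB.
  rewrite le_measure ?inE//; apply: subset_trans subN => x Lx [m _ nB].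
  by have [k /= mk Bk] := Lx m I; exact: (nB k).
have cvU : P (\bigcup_(k >= n) B k) @[n --> \oo] --> 0.
  rewrite -L0; apply: lim_sup_set_cvg => //.
  rewrite (@le_lt_trans _ _ 1) ?ltry// probability_le1//.
  exact: bigcup_measurable.
apply: (@squeeze_cvge _ _ _ _ (cst 0) _ (fun n => P (\bigcup_(k >= n) B k))).
- apply: nearW => n; rewrite measure_ge0/= le_measure ?inE//.
    exact: bigcup_measurable.
  by move=> x Bx; exists n => /=.
- exact: cvg_cst.
- exact: cvU.
Qed.

Lemma measure_eventually_le (P : probability T R) (B : (set T)^nat) (e : R) :
  (forall n, measurable (B n)) ->
  {ae P, forall x, \forall n \near \oo, ~ B n x} -> (0 < e)%R ->
  \forall n \near \oo, P (B n) <= e%:E.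
Proof.
move=> mB aeB e0.
have /fine_cvgP[_ /cvgrPdist_le /(_ e e0)] := measure_eventually0 mB aeB.
apply: filterS => n; rewrite /= sub0r normrN ger0_norm ?fine_ge0//.
by rewrite -lee_fin fineK// fin_num_measure.
Qed.

Lemma ae_exists (P : probability T R) (Q : set T) :
  {ae P, forall x, Q x} -> exists x, Q x.
Proof.
move=> [N [mN PN subN]]; apply: contrapT => nQ.
have NT : N = setT.
  by apply/seteqP; split => // x _; apply: subN => /= Qx; apply: nQ; exists x.
have := @probability_setT _ _ _ P; rewrite -NT PN => /eqP.
by rewrite eq_sym onee_eq0.
Qed.

End almost_everywhere.

(** * Relative entropy *)

Section relative_entropy.
Context d (T : measurableType d) (R : realType).
Variables (V mu : probability T R).

(** Under the domination, the density of [V] is at most [K] almost everywhere,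
    since the integral of its excess over [K] is nonpositive. *)
Lemma relative_entropy_le (K : R) : (0 < K)%R ->
  (forall E, measurable E -> V E <= K%:E * mu E) ->
  relative_entropy V mu <= (ln K)%:E.
Proof.
move=> K0 VK.
have Vmu : V `<< mu.
  apply/null_content_dominatesP => E mE muE0.
  by apply/eqP; rewrite -measure_le0 (le_trans (VK E mE))// muE0 mule0.
rewrite /relative_entropy; case: pselect => // _.
set f := 'd _ '/d _.
have mf : measurable_fun setT f.
  exact: measurable_int (Radon_Nikodym_integrable _).
rewrite -[leRHS]mule1 -(@probability_setT _ _ _ V) -integral_cst//.
apply: ae_le_integral => //.
  by apply: measurableT_comp => //; exact: measurable_lne.
pose E := f @^-1` `]K%:E, +oo[.
have mE : measurable E.
  by rewrite -[E]setTI; apply: mf => //; exact: emeasurable_itv.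
suff muE0 : mu E = 0.
  exists E; split => //.
    exact: (null_content_dominatesP _ _).1 Vmu _ mE muE0.
  move=> x /=; apply: contra_notP; rewrite /E/= in_itv/= andbT => /negP.
  rewrite -leNgt => fK.
  have [f0|f0] := leP (f x) 0; first by rewrite le0_lneNy ?leNye.
  by rewrite -lne_EFin// lee_lne// in_itv/= leey andbT// ?lee_fin ltW.
have If : mu.-integrable E f.
  by apply: (integrableS measurableT) => //; exact: Radon_Nikodym_integrable.
have IK : mu.-integrable E (cst K%:E) by exact: finite_measure_integrable_cst.
have IfK : mu.-integrable E (f \- cst K%:E) by exact: integrableB.
have fK x : E x -> K%:E < f x by rewrite /E/= in_itv/= andbT.
have : ae_eq mu E (f \- cst K%:E) (cst 0).
  apply/ae_eq_integral_abs => //; first exact: measurable_int IfK.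
  apply/eqP; rewrite eq_le integral_ge0// andbT.
  under eq_integral => x /set_mem Ex.
    rewrite gee0_abs; last by rewrite sube_ge0// ltW// fK.
    over.
  rewrite integralB// integral_cst// sube_le0//.
  rewrite -(@Radon_Nikodym_integral _ _ _ (charge_of_finite_measure V) mu)//.
  exact: VK.
move=> [N [mN muN EN]].
apply/eqP; rewrite -measure_le0 -muN le_measure ?inE//.
apply: subset_trans EN => x Ex /= /(_ Ex) fx0.
by have := fK x Ex; rewrite -sube_gt0 (fx0 : f x - K%:E = 0) ltxx.
Qed.

(** The Gibbs variational inequality.  With [f] the density of [V], the function
    [h = exp phi / f] has [V]-integral at most that of [exp phi] against [mu],
    hence at most [1], and [ln f >= phi + 1 - h] is the inequality
    [exp s >= 1 + s] at [s = phi - ln f]. *)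
Lemma relative_entropy_ge (phi : T -> R) : measurable_fun setT phi ->
  [bounded phi x | x in setT] -> \int[mu]_x (expR (phi x))%:E <= 1 ->
  \int[V]_x (phi x)%:E <= relative_entropy V mu.
Proof.
move=> mphi bphi iphi; rewrite /relative_entropy.
case: pselect => [Vmu|_]; last by rewrite leey.
set f := 'd _ '/d _.
have mf : measurable_fun setT f.
  exact: measurable_int (Radon_Nikodym_integrable _).
pose g := Radon_Nikodym_SigmaFinite.f V mu.
have mg : measurable_fun setT g.
  by exact: measurable_int (Radon_Nikodym_SigmaFinite.f_integrable _).
have g0 x : 0 <= g x by exact: Radon_Nikodym_SigmaFinite.f_ge0.
have gfin x : g x \is a fin_num by exact: Radon_Nikodym_SigmaFinite.f_fin_num.
have gf : ae_eq V setT g f.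
  exact: null_dominates_ae_eq (ae_eq_Radon_Nikodym_SigmaFinite _ _).
(* Where [g] vanishes, [ln 0 = 0] makes [h] finite; that set is [V]-null. *)
pose h x := (expR (phi x - ln (fine (g x))))%R.
have h0 x : (0 <= h x)%R by exact: expR_ge0.
have mh : measurable_fun setT h.
  apply: measurableT_comp => //; apply: measurable_funB => //.
  apply: (measurableT_comp (@measurable_ln R)).
  by apply: (measurableT_comp (@fine_measurable R _ measurableT)).
have hV : \int[V]_x (h x)%:E <= 1.
  rewrite -(Radon_Nikodym_SigmaFinite.change_of_variables Vmu)//; last first.
    exact/measurable_EFinP.
  apply: le_trans iphi; apply: ge0_le_integral => //.
  - by move=> x _; rewrite mule_ge0// lee_fin.
  - by apply: emeasurable_funM => //; exact/measurable_EFinP.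
  - by apply/measurable_EFinP; exact: measurableT_comp.
  - move=> x _; rewrite -/g -(fineK (gfin x)) -EFinM lee_fin /h/=.
    have [->|gx] := eqVneq (fine (g x)) 0%R; first by rewrite mulr0 expR_ge0.
    by rewrite expRB lnK ?posrE ?lt_def ?gx ?fine_ge0// divfK.
have Iphi : V.-integrable setT (EFin \o phi).
  by apply: measurable_bounded_integrable => //; rewrite ltey_eq fin_num_measure.
have Ih : V.-integrable setT (EFin \o h).
  apply/integrableP; split; first exact/measurable_EFinP.
  under eq_integral do rewrite gee0_abs ?lee_fin//.
  by rewrite (le_lt_trans hV)// ltry.
have I1 : V.-integrable setT (EFin \o cst 1%R) by exact: finite_measure_integrable_cst.
have mu1 : V setT = 1 by exact: probability_setT.
apply: (@le_trans _ _ (\int[V]_x ((phi x)%:E + 1%:E - (h x)%:E))).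
  have IhE : \int[V]_x (h x)%:E \is a fin_num.
    rewrite ge0_fin_numE ?(le_lt_trans hV) ?ltry// integral_ge0// => x _.
    by rewrite lee_fin.
  rewrite (@integralB _ _ _ V _ measurableT (fun x => (phi x)%:E + 1%:E))//.
    2: exact: integrableD.
  rewrite (@integralD _ _ _ V _ measurableT _ (cst 1%:E))//.
  rewrite integral_cst// [X in _ + _ * X - _]mu1 mule1 -addeA leeDl//.
  by rewrite sube_ge0 ?IhE.
apply: ae_le_integral.
- apply: emeasurable_funB; last exact/measurable_EFinP.
  by apply: emeasurable_funD; exact/measurable_EFinP.
- by apply: measurableT_comp => //; exact: measurable_lne.
have Vg0 : {ae V, forall x, g x != 0}.
  exists (g @^-1` [set 0]); split.
  - by rewrite -[X in measurable X]setTI; exact: mg.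
  - rewrite (Radon_Nikodym_SigmaFinite.f_integral Vmu)//; last first.
      by rewrite -[X in measurable X]setTI; exact: mg.
    by apply: integral0_eq => x; exact.
  - by move=> x /= /negP; rewrite negbK => /eqP.
apply: filterS2 gf Vg0 => x /= /(_ I) <- gx.
have gx0 : (0 < fine (g x))%R.
  by rewrite lt_def fine_ge0// andbT fine_eq0.
rewrite -(fineK (gfin x)) lne_EFin// -[leLHS]/((phi x + 1 - h x)%:E) lee_fin /h/=.
set y := fine (g x) in gx0 *.
have := @expR_ge1Dx R (phi x - ln y); lra.
Qed.
End relative_entropy.

(** * Conditioning a product measure on a set *)

Section conditioning.
Context d1 d2 (U : measurableType d1) (W : measurableType d2) (R : realType).
Variables (P : probability U R) (Q : probability W R).

(** The first coordinate keeps its law [P] and, given [x], the second one has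
    the law [Q] conditioned on the section of [S] at [x]. *)
Lemma conditioned_product (S : set (U * W)) (q : R) :
  measurable S -> (0 < q)%R -> (forall x, q%:E <= Q (xsection S x)) ->
  exists V : probability (U * W)%type R,
    [/\ forall C, measurable C -> V (C `*` setT) = P C,
        V (~` S) = 0 &
        forall E, measurable E -> V E <= q^-1%:E * (P \x Q) E].
Proof.
move=> mS q0 qS.
pose s x := fine (Q (xsection S x)).
have sE x : Q (xsection S x) = (s x)%:E.
  by rewrite fineK// fin_num_measure//; exact: measurable_xsection.
have qs x : (q <= s x)%R by rewrite -lee_fin -sE.
have s0 x : (0 < s x)%R by exact: lt_le_trans (qs x).
have ms : measurable_fun setT s.
  apply: (measurableT_comp (@fine_measurable R _ measurableT)).
  exact: measurable_fun_xsection.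
(* the inverse of [s] as [exp (- ln s)], both known to be measurable *)
pose f (z : U * W) := (\1_S z * expR (- ln (s z.1)))%:E.
have fE z : f z = (\1_S z / s z.1)%:E by rewrite /f expRN lnK// posrE.
have mf : measurable_fun setT f.
  apply/measurable_EFinP; apply: measurable_funM => //.
  do 2 apply: measurableT_comp => //.
  by apply: measurableT_comp => //; exact: measurableT_comp.
have f0 z : 0 <= f z by rewrite fE lee_fin divr_ge0// ltW.
have fq z : f z <= q^-1%:E.
  rewrite fE lee_fin (@le_trans _ _ ((s z.1)^-1)%R)//.
    by rewrite ler_pdivrMr// mulVf ?gt_eqF// indicE lern1 leq_b1.
  by rewrite lef_pV2 ?posrE.
have iC C : measurable C -> \int[P \x Q]_(z in C `*` setT) f z = P C.
  move=> mC; have mCT : measurable (C `*` [set: W]) by exact: measurableX.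
  rewrite integral_mkcond fubini_tonelli1//; last 2 first.
    by apply/(measurable_restrictT _ _).1 => //; exact: measurable_funTS.
    by move=> z; exact: erestrict_ge0.
  rewrite -[in RHS](setIT C) -integral_indic//.
  apply: eq_integral => x _; rewrite /fubini_F.
  transitivity (\int[Q]_y ((\1_C x * (s x)^-1)%:E * (\1_(xsection S x) y)%:E)).
    apply: eq_integral => y _; rewrite patchE -EFinM.
    rewrite in_setX in_setT andbT (indicE _ C).
    case: ifPn => _; last by rewrite !mul0r.
    by rewrite fE mul1r mulrC !indicE /= mem_xsection.
  rewrite ge0_integralZl//; last 2 first.
    apply/measurable_EFinP; apply: measurable_indic.
    exact: measurable_xsection.
    by rewrite lee_fin mulr_ge0// invr_ge0 ltW.
  rewrite integral_indic//; last exact: measurable_xsection.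
  by rewrite setIT [X in _ * X]sE -EFinM -mulrA mulVf ?mulr1// gt_eqF.
have f1 : \int[P \x Q]_z f z = 1.
  by rewrite -setXTT iC// probability_setT.
have [V VE] := @probability_of_density _ _ _ (P \x Q) f mf f0 f1.
exists V; split.
- by move=> C mC; rewrite VE iC.
- rewrite VE; apply: integral0_eq => z /= Sz.
  by rewrite fE indicE memNset// mul0r.
- move=> E mE; rewrite VE -integral_cst//; apply: ge0_le_integral => //.
  exact: measurable_funTS.
Qed.
End conditioning.

(** * Bounds on the rate-distortion function at a fixed block length *)

Section rate_function_bounds.
Context d1 (A : measurableType d1) d2 (B : measurableType d2) (R : realType).
Variables (rho : A -> B -> R) (M : R).
Hypothesis rho_ge0 : forall x y, (0 <= rho x y)%R.
Hypothesis rho_le : forall x y, (rho x y <= M)%R.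
Hypothesis rho_meas :
  measurable_fun [set: A * B] (fun z : A * B => rho z.1 z.2).

Lemma rho_n_ge0 n (x : n.-tuple A) (y : n.-tuple B) : (0 <= rho_n rho x y)%R.
Proof. by rewrite /rho_n mulr_ge0 ?invr_ge0 ?sumr_ge0. Qed.

Lemma rho_n_le n (x : n.-tuple A) (y : n.-tuple B) : (0 < n)%N ->
  (rho_n rho x y <= M)%R.
Proof.
move=> n0; rewrite /rho_n ler_pdivrMl ?ltr0n//.
rewrite (@le_trans _ _ (\sum_(i < n) M)%R)//; first exact: ler_sum.
by rewrite sumr_const card_ord mulr_natl.
Qed.

Lemma measurable_rho_n n : measurable_fun [set: n.-tuple A * n.-tuple B]
  (fun z : n.-tuple A * n.-tuple B => rho_n rho z.1 z.2).
Proof.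
apply: measurable_funM => //; apply: measurable_sum => i.
pose h (z : n.-tuple A * n.-tuple B) := (tnth z.1 i, tnth z.2 i).
have mh : measurable_fun setT h.
  by apply: measurable_fun_pair; apply: (measurableT_comp (measurable_tnth i)).
exact: (measurableT_comp rho_meas mh).
Qed.

Lemma measurable_rho_nr n (x : n.-tuple A) :
  measurable_fun [set: n.-tuple B] (rho_n rho x).
Proof. exact: (measurable_fun_pair2 x (@measurable_rho_n n)). Qed.

Variables (n : nat) (n_gt0 : (0 < n)%N).
Variables (Pn : probability (n.-tuple A) R) (Qn : probability (n.-tuple B) R).

(** The Gibbs inequality for the tilt [n lam rho_n - n b \1_G(x)].  On [G]
    the hypothesis normalizes it; off [G] the exponent [n lam rho_n] is
    nonpositive, so its exponential is already at most [1]. *)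
Lemma R_n_ge (lam b D : R) (G : set (n.-tuple A)) : (lam <= 0)%R ->
  measurable G ->
  (forall x, G x ->
    \int[Qn]_y (expR (n%:R * lam * rho_n rho x y))%:E <= (expR (n%:R * b))%:E) ->
  (lam * D - b * fine (Pn G))%:E <= R_n rho Pn Qn D.
Proof.
move=> lam0 mG HG; apply: le_ereal_inf_tmp => _ /= [V [margV distV] <-].
have n0 : (0 < n%:R :> R)%R by rewrite ltr0n.
pose phi (z : n.-tuple A * n.-tuple B) : R :=
  (n%:R * lam * rho_n rho z.1 z.2 - n%:R * b * \1_G z.1)%R.
have mrho := @measurable_rho_n n.
have m1 : measurable_fun setT
    (fun z : n.-tuple A * n.-tuple B => \1_G z.1 : R).
  by apply: (@measurableT_comp _ _ _ _ _ _ (\1_G : _ -> R) setT fst).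
have mphi : measurable_fun setT phi.
  by apply: measurable_funB; apply: measurable_funM.
have r0 := @rho_n_ge0 n; have rM x y := @rho_n_le n x y n_gt0.
have bphi : [bounded phi z | z in setT].
  exists (`|n%:R * lam * M| + `|n%:R * b|)%R; split; first exact: num_real.
  move=> x xM z _ /=; rewrite (le_trans _ (ltW xM))// (le_trans (ler_normB _ _))//.
  apply: lerD.
    rewrite [leLHS]normrM [leRHS]normrM ler_wpM2l//.
    by rewrite ger0_norm// (le_trans (rM _ _))// ler_norm.
  by rewrite normrM -[leRHS]mulr1 ler_wpM2l// indicE normr_nat lern1 leq_b1.
have iphi : \int[Pn \x Qn]_z (expR (phi z))%:E <= 1.
  have e0 z : 0 <= (expR (phi z))%:E by rewrite lee_fin expR_ge0.
  have me : measurable_fun setT (fun z => (expR (phi z))%:E).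
    by apply/measurable_EFinP; exact: measurableT_comp.
  rewrite (fubini_tonelli1 _ me e0).
  rewrite -(@probability_setT _ _ _ Pn) -[leRHS]mul1e -integral_cst//.
  apply: ge0_le_integral => //.
  - by move=> x _; apply: integral_ge0.
  - exact: measurable_fun_fubini_tonelli_F.
  move=> x _; rewrite /fubini_F/=.
  have mrx : measurable_fun setT (fun y => expR (n%:R * lam * rho_n rho x y)).
    apply: measurableT_comp => //; apply: measurable_funM => //.
    exact: measurable_rho_nr.
  have [Gx|nGx] := pselect (G x).
    under eq_integral => y _ do
      rewrite /phi/= indicE mem_set// mulr1 expRD mulrC EFinM.
    rewrite ge0_integralZl//; last exact/measurable_EFinP.
    apply: le_trans (lee_wpmul2l _ (HG x Gx)) _; first by rewrite lee_fin.
    by rewrite -EFinM -expRD addrC subrr expR0.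
  rewrite -(@probability_setT _ _ _ Qn) -[leRHS]mul1e -integral_cst//.
  apply: ge0_le_integral => //.
  - apply/measurable_EFinP; apply: (measurableT_comp (@measurable_expR R)).
    exact: (measurable_fun_pair2 x mphi).
  - move=> y _; rewrite lee_fin expR_le1 /phi/= indicE memNset// mulr0 subr0.
    by rewrite mulr_le0_ge0// mulr_ge0_le0// ltW.
have Vfin (f : n.-tuple A * n.-tuple B -> R) :
    measurable_fun setT f -> [bounded f z | z in setT] ->
    V.-integrable setT (EFin \o f).
  move=> mf bf; apply: measurable_bounded_integrable => //.
  by rewrite ltey_eq fin_num_measure.
have Irho : V.-integrable setT (fun z => (rho_n rho z.1 z.2)%:E).
  apply: Vfin => //; exists M; split; first exact: num_real.
  by move=> x xM z _ /=; rewrite ger0_norm// (le_trans _ (ltW xM)).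
have I1 : V.-integrable setT (fun z => (\1_G z.1 : R)%:E).
  apply: Vfin => //; exists 1%R; split; first exact: num_real.
  move=> x xM z _ /=.
  by rewrite indicE normr_nat (le_trans _ (ltW xM))// lern1 leq_b1.
have intV : \int[V]_z (phi z)%:E =
    (n%:R * lam)%:E * \int[V]_z (rho_n rho z.1 z.2)%:E
    - (n%:R * b)%:E * Pn G.
  rewrite -margV//; under eq_integral do rewrite /phi EFinB !(EFinM (_ * _)).
  rewrite integralB//; last 2 first.
  - exact: integrableZl.
  - exact: integrableZl.
  rewrite !integralZl//; congr (_ - _ * _).
  rewrite [RHS](_ : _ = V (G `*` setT `&` setT)); last by rewrite setIT.
  rewrite -integral_indic//; last exact: measurableX.
  by apply: eq_integral => z _; rewrite !indicE in_setX in_setT andbT.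
have PG : Pn G = (fine (Pn G))%:E by rewrite fineK// fin_num_measure.
have eD : \int[V]_z (rho_n rho z.1 z.2)%:E \is a fin_num.
  rewrite ge0_fin_numE; first by rewrite (le_lt_trans distV)// ltry.
  by apply: integral_ge0 => z _; rewrite lee_fin.
have := @relative_entropy_ge _ _ _ V (Pn \x Qn) phi mphi bphi iphi.
rewrite intV PG -(fineK eD) -!EFinM -EFinB.
set H := relative_entropy _ _ => HH.
rewrite muleC lee_pdivlMr ?ltr0n// (le_trans _ HH)//.
rewrite -EFinM lee_fin.
have : (fine (\int[V]_z (rho_n rho z.1 z.2)%:E)%E <= D)%R by rewrite -lee_fin fineK.
set e := fine _ => eDD.
have : (lam * D <= lam * e)%R by rewrite ler_wnM2l.
rewrite -(ler_pM2l n0). lra.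
Qed.

Lemma measurable_ball_mass (g : n.-tuple A -> R) : measurable_fun setT g ->
  measurable_fun setT (fun x => Qn [set y | (rho_n rho x y <= g x)%R]).
Proof.
move=> mg; pose S := [set z : n.-tuple A * n.-tuple B |
  (rho_n rho z.1 z.2 <= g z.1)%R].
have mS : measurable S.
  rewrite -[S]setTI; apply: measurable_fun_ler => //; first exact: measurable_rho_n.
  exact: (measurableT_comp mg).
rewrite (_ : (fun x => _) = (fun x => Qn (xsection S x))).
  exact: measurable_fun_xsection.
by apply/funext => x; rewrite xsectionE.
Qed.

(** Given the first block [x], the second one is drawn from [Qn] conditioned on
    the ball of radius [g x], except at the [x] whose ball has mass less than
    [q], where [Qn] is kept.  The density is at most [1 / q]. *)
Lemma R_n_le (q D : R) (g : n.-tuple A -> R) : measurable_fun setT g ->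
  (forall x, (0 <= g x)%R) -> (0 < q <= 1)%R ->
  \int[Pn]_x (g x)%:E
  + M%:E * Pn [set x | Qn [set y | (rho_n rho x y <= g x)%R] < q%:E] <= D%:E ->
  R_n rho Pn Qn D <= (n%:R^-1 * - ln q)%:E.
Proof.
move=> mg g0 /andP[q0 q1]; set bad := [set x | _] => intD.
have n0 : (0 < n%:R :> R)%R by rewrite ltr0n.
have [r0 rM] := (@rho_n_ge0 n, fun x y => @rho_n_le n x y n_gt0).
have M0 : (0 <= M)%R.
  have [x _] : exists x : n.-tuple A, True.
    by apply: (@ae_exists _ _ _ Pn (fun=> True)); exact: aeW.
  have [y _] : exists y : n.-tuple B, True.
    by apply: (@ae_exists _ _ _ Qn (fun=> True)); exact: aeW.
  exact: le_trans (r0 x y) (rM x y).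
have mbad : measurable bad.
  rewrite -[bad]setTI; apply: measurable_fun_lte => //.
  exact: measurable_ball_mass.
(* At a bad [x] the radius is at least [M], so that the ball is the whole space. *)
pose h x := (g x + M * \1_bad x)%R.
have mh : measurable_fun setT h.
  by apply: measurable_funD => //; apply: measurable_funM.
pose S := [set z : n.-tuple A * n.-tuple B | (rho_n rho z.1 z.2 <= h z.1)%R].
have mS : measurable S.
  rewrite -[S]setTI; apply: measurable_fun_ler => //; first exact: measurable_rho_n.
  exact: (measurableT_comp mh).
have h0 x : (0 <= h x)%R by rewrite addr_ge0 ?mulr_ge0.
have qS x : q%:E <= Qn (xsection S x).
  rewrite (_ : xsection S x = [set y | (rho_n rho x y <= h x)%R]); last first.
    by rewrite xsectionE.
  rewrite /h indicE; have [bx|nbx] := pselect (bad x).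
    rewrite (_ : [set y | _] = setT) ?probability_setT//.
    apply/seteqP; split => // y _ /=.
    by rewrite mem_set// mulr1 (le_trans (rM x y))// lerDr.
  by rewrite memNset// mulr0 addr0 leNgt; apply/negP.
have [V [margV VS VE]] := conditioned_product Pn mS q0 qS.
apply: (@le_trans _ _ (n%:R^-1%:E * relative_entropy V (Pn \x Qn))).
  apply: ereal_inf_lbound; exists V => //; split => //.
  apply: le_trans intD.
  apply: (@le_trans _ _ (\int[V]_z (h z.1)%:E)).
    apply: ae_le_integral.
    - by apply/measurable_EFinP; exact: measurable_rho_n.
    - by apply/measurable_EFinP; exact: (measurableT_comp mh).
    - exists (~` S); split => //; exact: measurableC.
  have -> : \int[V]_z (h z.1)%:E = \int[Pn]_x (h x)%:E.
    rewrite [RHS](@eq_measure_integral _ _ _ _ (pushforward V fst)).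
      rewrite ge0_integral_pushforward//=.
      - exact/measurable_EFinP.
      - by move=> x _; rewrite lee_fin.
    move=> C mC _; apply: etrans (esym (margV C mC)) _; congr (V _).
    by apply/seteqP; split => // z [].
  under eq_integral do rewrite /h EFinD EFinM.
  rewrite ge0_integralD//=.
  - rewrite ge0_integralZl//=; last exact/measurable_EFinP.
    by rewrite integral_indic// setIT.
  - by move=> x _; rewrite lee_fin.
  - exact/measurable_EFinP.
  - by move=> x _; rewrite mule_ge0// lee_fin.
  - by apply: emeasurable_funM; apply/measurable_EFinP.
rewrite EFinM lee_wpmul2l ?lee_fin ?invr_ge0//.
rewrite -lnV ?posrE//; apply: relative_entropy_le => //.
by rewrite invr_gt0.
Qed.

End rate_function_bounds.

Section ess_inf_measurable.
Context d1 d2 (U : measurableType d1) (W : measurableType d2) (R : realType).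
Variables (Q : probability W R) (f : U * W -> R).
Hypothesis mf : measurable_fun setT f.

(** The essential infimum is at least [a] exactly where the sections of
    [f < a] are negligible, and the mass of a section is measurable. *)
Lemma measurable_ess_inf :
  measurable_fun setT (fun x => ess_inf Q (fun y => (f (x, y))%:E)).
Proof.
apply: (measurability _ (ErealGenCInfty.measurableE R)).
move=> /= _ [_ [a ->]] <-; rewrite setTI.
pose S := [set z : U * W | (f z < a)%R].
have mS : measurable S by rewrite -[S]setTI; exact: measurable_fun_ltr.
rewrite [X in measurable X](_ : _ = (fun x => Q (xsection S x)) @^-1` [set 0]).
  by rewrite -[X in measurable X]setTI; apply: measurable_fun_xsection.
apply/seteqP; split => x /=; rewrite in_itv/= andbT.
  move/ess_infP => [N [mN QN subN]].
  apply/eqP; rewrite -measure_le0 -QN le_measure ?inE//.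
    exact: measurable_xsection.
  apply: subset_trans subN => y; rewrite xsectionE /S/= => fa /=.
  by rewrite lee_fin leNgt fa.
move=> QS; apply/ess_infP; exists (xsection S x); split => //.
  exact: measurable_xsection.
by move=> y /= /negP; rewrite lee_fin -ltNge xsectionE.
Qed.

End ess_inf_measurable.

Section rate_function_finite.
Context d1 (A : measurableType d1) d2 (B : measurableType d2) (R : realType).
Variables (rho : A -> B -> R) (M : R).
Hypothesis rho_ge0 : forall x y, (0 <= rho x y)%R.
Hypothesis rho_le : forall x y, (rho x y <= M)%R.
Hypothesis rho_meas :
  measurable_fun [set: A * B] (fun z : A * B => rho z.1 z.2).
Variables (n : nat) (n_gt0 : (0 < n)%N).
Variables (Pn : probability (n.-tuple A) R) (Qn : probability (n.-tuple B) R).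

(** Every ball whose radius exceeds the essential infimum has positive mass; so
    the blocks at which the mass of such a ball is less than [1 / k] become
    rare, and [R_n_le] applies for a large [k]. *)
Lemma R_n_lty (D : R) :
  \int[Pn]_x ess_inf Qn (fun y => (rho_n rho x y)%:E) < D%:E ->
  R_n rho Pn Qn D < +oo.
Proof.
set m := fun x => ess_inf Qn (fun y => (rho_n rho x y)%:E) => mD.
have mm : measurable_fun setT m.
  exact: (measurable_ess_inf Qn (measurable_rho_n rho_meas (n:=n))).
have Q1 : 0 < Qn setT by rewrite probability_setT.
have m0 x : 0 <= m x.
  apply: ess_inf_gee => //; apply: aeW => y; rewrite lee_fin; exact: rho_n_ge0.
have mM x : m x <= M%:E.
  rewrite -(@ess_inf_cst _ _ _ Qn M%:E Q1); apply: le_ess_inf.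
  by apply: aeW => y; rewrite lee_fin; exact: rho_n_le.
have mE x : m x = (fine (m x))%:E.
  by rewrite fineK// ge0_fin_numE// (le_lt_trans (mM x))// ltry.
have im0 : 0 <= \int[Pn]_x m x by exact: integral_ge0.
have imE : \int[Pn]_x m x = (fine (\int[Pn]_x m x))%:E.
  by rewrite fineK// ge0_fin_numE// (lt_trans mD)// ltry.
set e := fine _ in imE.
have eD : (e < D)%R by rewrite -lte_fin -imE.
pose del := ((D - e) / 2)%R.
have del0 : (0 < del)%R by rewrite divr_gt0// subr_gt0.
pose g x := (fine (m x) + del)%R.
have mfm : measurable_fun setT (fun x => fine (m x)).
  exact: (measurableT_comp (@fine_measurable R _ measurableT)).
have mg : measurable_fun setT g by exact: measurable_funD.
have g0 x : (0 <= g x)%R by rewrite addr_ge0 ?fine_ge0// ltW.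
pose mass x := Qn [set y | (rho_n rho x y <= g x)%R].
have mmass : measurable_fun setT mass by exact: measurable_ball_mass.
have mass0 x : 0 < mass x.
  rewrite lt_def measure_ge0 andbT; apply/negP => /eqP mass0.
  have : (g x)%:E <= m x.
    apply/ess_infP; exists [set y | (rho_n rho x y <= g x)%R]; split => //.
      rewrite -[X in measurable X]setTI; apply: measurable_fun_ler => //.
      exact: measurable_rho_nr.
    by move=> y /= /negP; rewrite lee_fin -ltNge => /ltW.
  by rewrite mE lee_fin /g gerDl leNgt del0.
pose bad (k : nat) := [set x | mass x < (k.+1%:R^-1)%:E].
have mbad k : measurable (bad k).
  by rewrite -[bad k]setTI; exact: measurable_fun_lte.
have c0 : (0 < del / (`|M| + 1))%R by rewrite divr_gt0// ltr_wpDl.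
have [k kbad] : exists k, Pn (bad k) <= (del / (`|M| + 1))%:E.
  have : {ae Pn, forall x, \forall k \near \oo, ~ bad k x}.
    apply: aeW => x.
    have [s sE] : exists s, mass x = s%:E.
      exists (fine (mass x)); rewrite fineK// fin_num_measure//.
      rewrite -[X in measurable X]setTI; apply: measurable_fun_ler => //.
      exact: measurable_rho_nr.
    have s0 : (0 < s)%R by rewrite -lte_fin -sE.
    have := near_infty_natSinv_lt (PosNum s0); apply: filterS => k /= ks.
    by rewrite /bad/= sE lte_fin => /(lt_trans ks); rewrite ltxx.
  by move=> /(measure_eventually_le mbad)/(_ c0)[k _ /(_ k (leqnn _))]; exists k.
apply: (@le_lt_trans _ _ (n%:R^-1 * - ln k.+1%:R^-1)%:E); last exact: ltry.
apply: (R_n_le rho_ge0 rho_le rho_meas n_gt0 mg g0).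
  by rewrite invr_gt0 ltr0n/= invf_le1 ?ltr0n// ler1n.
have -> : \int[Pn]_x (g x)%:E = e%:E + del%:E.
  under eq_integral do rewrite /g EFinD -mE.
  rewrite ge0_integralD//=; last by move=> x _; rewrite lee_fin ltW.
  by rewrite imE integral_cst// [X in _ + _ * X]probability_setT mule1.
have Mbad : M%:E * Pn (bad k) <= del%:E by exact: lee_mul_small.
apply: (le_trans (leeD2l _ Mbad)).
by rewrite -!EFinD lee_fin /del; lra.
Qed.

End rate_function_finite.

(** * Kernels that give the conditional law of an independent variable *)

Section kernel_product.
Context d1 d2 (U : measurableType d1) (W : measurableType d2) (R : realType).
Variables (P : probability U R) (k : R.-pker U ~> W).

(** The joint law of [(x, y)] when [x] has law [P] and [y] has law [k x] given
    [x]. *)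
Definition kernel_product (E : set (U * W)) : \bar R :=
  \int[P]_x k x (xsection E x).

Let measurable_kernel_section E : measurable E ->
  measurable_fun setT (fun x => k x (xsection E x)).
Proof.
by move=> mE; apply: measurable_fun_xsection_finite_kernel; rewrite inE.
Qed.

Let kernel_product0 : kernel_product set0 = 0.
Proof. by apply: integral0_eq => x _; rewrite xsection0. Qed.

Let kernel_product_ge0 E : 0 <= kernel_product E.
Proof. exact: integral_ge0. Qed.

Let kernel_product_sigma_additive : semi_sigma_additive kernel_product.
Proof.
move=> F mF tF mUF.
rewrite [X in _ --> X](_ : _ = \sum_(n <oo) kernel_product (F n)).
  by apply/cvg_closeP; split; [exact: is_cvg_nneseries|rewrite closeE].
rewrite -integral_nneseries//; last by move=> n; exact: measurable_kernel_section.
apply: eq_integral => x _; apply/esym/cvg_lim => //=; rewrite xsection_bigcup.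
apply: (measure_sigma_additive _ (trivIset_xsection tF)) => ?.
exact: measurable_xsection.
Qed.

HB.instance Definition _ := isMeasure.Build _ _ _ kernel_product
  kernel_product0 kernel_product_ge0 kernel_product_sigma_additive.

(** The joint law agrees with [P \x Q] on rectangles, hence everywhere;
    restricting it to [C `*` setT] for each [C]
    identifies the two functions of [x]. *)
Lemma kernel_ae_eq_xsection (Q : probability W R) :
  (forall C D, measurable C -> measurable D ->
     \int[P]_(x in C) k x D = P C * Q D) ->
  forall E, measurable E ->
  {ae P, forall x, k x (xsection E x) = Q (xsection E x)}.
Proof.
move=> kPQ E mE.
have prodE F : measurable F -> (P \x Q) F = kernel_product F.
  apply: product_measure_unique => C D mC mD.
  rewrite /= -kPQ// /kernel_product [RHS]integral_mkcond; apply: eq_integral => x _.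
  rewrite patchE; case: ifPn => [/set_mem|/negP] xC.
    by rewrite in_xsectionX// inE.
  by rewrite notin_xsectionX ?measure0//; apply/negP.
have k1 (x : U) F : measurable F -> k x F <= 1.
  by move=> mF; rewrite (le_trans _ (sprob_kernel_le1 k x))// le_measure ?inE.
have : ae_eq P setT (fun x => k x (xsection E x)) (fun x => Q (xsection E x)).
  apply: integral_ae_eq => //.
  - apply/integrableP; split; first exact: measurable_kernel_section.
    apply: (@le_lt_trans _ _ (\int[P]_x cst 1 x)).
      apply: ge0_le_integral => //.
      + by apply: measurableT_comp => //; exact: measurable_kernel_section.
      + by move=> x _; rewrite gee0_abs// k1//; exact: measurable_xsection.
    by rewrite integral_cst// mul1e (le_lt_trans (probability_le1 _ _))// ltry.
  - exact: measurable_fun_xsection.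
  - move=> C _ mC.
    have mEC : measurable (E `&` (C `*` setT)).
      by apply: measurableI => //; exact: measurableX.
    have restr (f : U -> set W -> \bar R) : (forall x, f x set0 = 0) ->
        \int[P]_(x in C) f x (xsection E x) =
        \int[P]_x f x (xsection (E `&` (C `*` setT)) x).
      move=> f0; rewrite [LHS]integral_mkcond; apply: eq_integral => x _.
      rewrite patchE xsectionI; case: ifPn => [/set_mem|/negP] xC.
        by rewrite in_xsectionX ?inE// setIT.
      by rewrite notin_xsectionX ?setI0 ?f0//; apply/negP.
    rewrite (restr (fun x => k x)); last by move=> x; exact: measure0.
    rewrite (restr (fun=> Q)); last by move=> x; exact: measure0.
    by have := prodE _ mEC; rewrite /kernel_product => <-.
by apply: filterS => x /= /(_ I).
Qed.

End kernel_product.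

(** * Random distortion balls and the limit *)

Section random_balls.
Context d1 (A : measurableType d1) d2 (B : measurableType d2).
Context d (Omega : measurableType d) (R : realType) (Pr : probability Omega R).
Variables (X : nat -> {RV Pr >-> A}) (Y : nat -> {RV Pr >-> B}).
Variables (rho : A -> B -> R) (M : R).
Hypothesis rho_ge0 : forall x y, (0 <= rho x y)%R.
Hypothesis rho_le : forall x y, (rho x y <= M)%R.
Hypothesis rho_meas :
  measurable_fun [set: A * B] (fun z : A * B => rho z.1 z.2).

Lemma measurable_first_n d' (T : measurableType d') n :
  measurable_fun [set: path_space T] (@first_n _ T n).
Proof.
apply/measurable_fun_tnthP => i.
rewrite (_ : _ \o _ = (fun x : path_space T => x i)); last first.
  by apply/funext => x /=; rewrite tnth_mktuple.
move=> _ C mC; rewrite setTI; apply: sub_sigma_algebra.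
by exists (nat_of_ord i) => //; exists C => //; rewrite setTI.
Qed.

(** The first [n] coordinates are read off a whole path, as the almost sure
    statements are about one path and all [n]. *)
Definition ball_rate (x : path_space A) (a : R) (n : nat) : \bar R :=
  - (n%:R^-1%:E * lne (block_law Y n (distortion_ball rho (first_n n x) a))).

Lemma measurable_distortion_ball n (x : n.-tuple A) (a : R) :
  measurable (distortion_ball rho x a).
Proof.
rewrite -[X in measurable X]setTI; apply: measurable_fun_ler => //.
exact: measurable_rho_nr.
Qed.

Lemma le_ball_mass (x : path_space A) a n (t : R) : (0 < n)%N ->
  t%:E <= ball_rate x a n ->
  block_law Y n (distortion_ball rho (first_n n x) a) <= (expR (n%:R * - t))%:E.
Proof.
move=> n0; rewrite /ball_rate; set m := block_law _ _ _.
have m0 : 0 <= m by exact: measure_ge0.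
rewrite leeNr -EFinN muleC lee_pdivrMr ?ltr0n// -EFinM => h.
rewrite -(lneK (x := m)) ?in_itv/= ?m0 ?leey//.
by rewrite -[leRHS]/(expeR (n%:R * - t)%:E) lee_expeR mulrC.
Qed.

Lemma ge_ball_mass (x : path_space A) a n (t : R) : (0 < n)%N ->
  ball_rate x a n <= t%:E ->
  (expR (n%:R * - t))%:E <= block_law Y n (distortion_ball rho (first_n n x) a).
Proof.
move=> n0; rewrite /ball_rate; set m := block_law _ _ _.
have m0 : 0 <= m by exact: measure_ge0.
rewrite leeNl -EFinN muleC lee_pdivlMr ?ltr0n// -EFinM => h.
rewrite -(lneK (x := m)) ?in_itv/= ?m0 ?leey//.
by rewrite -[leLHS]/(expeR (n%:R * - t)%:E) lee_expeR mulrC.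
Qed.

Section conditional_ldp.
Hypothesis indepXY : independent_processes X Y.
Variable kappa : R.-pker (path_space A) ~> (path_space B).
Hypothesis kappaXY : conditional_law X Y kappa.

(** For a fixed radius the ball events, seen as sets of pairs of paths, form a
    sequence, so one null set serves all of them. *)
Lemma conditional_ball_mass (a : R) :
  {ae process_law X, forall x, forall n,
    kappa x ((fun y => rho_n rho (first_n n x) (first_n n y)) @^-1` `]-oo, a]) =
    block_law Y n (distortion_ball rho (first_n n x) a)}.
Proof.
apply: ae_foralln => n.
pose E := [set z : path_space A * path_space B |
  (rho_n rho (first_n n z.1) (first_n n z.2) <= a)%R].
have mE : measurable E.
  rewrite -[E]setTI; apply: measurable_fun_ler => //.
  pose h (z : path_space A * path_space B) := (first_n n z.1, first_n n z.2).
  have mh : measurable_fun setT h.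
    by apply: measurable_fun_pair; apply: (measurableT_comp (measurable_first_n (n:=n))).
  exact: (measurableT_comp (measurable_rho_n rho_meas (n:=n)) mh).
have indep C D : measurable C -> measurable D ->
    \int[process_law X]_(x in C) kappa x D = process_law X C * process_law Y D.
  by move=> mC mD; rewrite -(kappaXY mC mD) (indepXY mC mD).
apply: filterS (kernel_ae_eq_xsection indep mE) => x; rewrite xsectionE => kx.
by rewrite (_ : _ @^-1` _ = (fun y => (x, y)) @^-1` E).
Qed.

Variable I : R -> \bar R.
Hypothesis ldp : {ae process_law X, forall x : path_space A,
  LDP (kappa x)
    (fun n (y : path_space B) => rho_n rho (first_n n x) (first_n n y)) I}.

Lemma ball_rate_ldp (a : R) :
  {ae process_law X, forall x : path_space A,
    (forall c : R, c%:E < lower_rate I a ->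
       \forall n \near \oo, c%:E <= ball_rate x a n) /\
    (forall z c : R, (z < a)%R -> I z < c%:E ->
       \forall n \near \oo, ball_rate x a n <= c%:E)}.
Proof.
apply: filterS2 ldp (conditional_ball_mass a) => x [_ _ ldpx] massx.
have /ldpx[] : measurable (`]-oo, a] : set R) by exact: measurable_itv.
under [X in limn_einf X]eq_fun do rewrite massx.
under [X in limn_esup X]eq_fun do rewrite massx.
set l := fun n : nat => _ => lo _ up.
have lE n : ball_rate x a n = - l n by [].
split=> [c cI|z c za Izc].
- have : limn_esup l < (- c)%:E.
    apply: (le_lt_trans up); rewrite EFinN lteN2; apply: (lt_le_trans cI).
    apply: ereal_inf_le_tmp => _ /= [z + <-] => za; exists z => //=.
    by move: za; rewrite set_itvNyc -((closure_id _).1 (@closed_le _ a)).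
  move/limn_esup_lt_near; apply: filterS => n ln.
  by rewrite lE leeNr -EFinN ltW.
- have : (- c)%:E < limn_einf l.
    apply: lt_le_trans lo; rewrite EFinN lteN2; apply: le_lt_trans Izc.
    apply: ereal_inf_lbound; exists z => //.
    have oz : open_nbhs z [set y : R | (y < a)%R].
      by split => //; exact: open_lt.
    apply: filterS (open_nbhs_nbhs oz) => y /= /ltW.
    by rewrite in_itv.
  move/limn_einf_gt_near; apply: filterS => n ln.
  by rewrite lE leeNl -EFinN ltW.
Qed.

(** As [lam <= 0], on the cell from [a k] to [a k.+1] the exponential is at most
    its value at [a k], and the cell lies in the ball of radius
    [a k.+1]. *)
Lemma exp_moment_le n (Qn : probability (n.-tuple B) R) (x : n.-tuple A)
    (lam : R) (K : nat) (a : nat -> R) :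
  (0 < n)%N -> (0 < K)%N -> (lam <= 0)%R -> (a 0%N <= 0)%R -> (M <= a K)%R ->
  \int[Qn]_y (expR (n%:R * lam * rho_n rho x y))%:E <=
  \sum_(k < K) (expR (n%:R * lam * a k))%:E * Qn (distortion_ball rho x (a k.+1)).
Proof.
move=> n0 K0 lam0 a0 aK.
have mball k := measurable_distortion_ball x (a k).
pose f (k : 'I_K) (y : n.-tuple B) : \bar R :=
  (expR (n%:R * lam * a k))%:E * (\1_(distortion_ball rho x (a k.+1)) y)%:E.
have f0 k y : 0 <= f k y by rewrite mule_ge0 ?lee_fin ?expR_ge0.
have mf k : measurable_fun setT (f k).
  apply: emeasurable_funM => //; apply/measurable_EFinP.
  exact: measurable_indic.
have -> : \sum_(k < K)
      (expR (n%:R * lam * a k))%:E * Qn (distortion_ball rho x (a k.+1)) =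
    \int[Qn]_y \sum_(k < K) f k y.
  rewrite ge0_integral_sum//; apply: eq_bigr => k _.
  rewrite ge0_integralZl//; last first.
    by apply/measurable_EFinP; exact: measurable_indic.
  by rewrite integral_indic// setIT.
apply: ge0_le_integral => //.
- apply/measurable_EFinP; apply: measurableT_comp => //.
  by apply: measurable_funM => //; exact: measurable_rho_nr.
- exact: emeasurable_sum.
move=> y _; have [k ak ak1] := grid_cell (le_trans a0 (rho_n_ge0 rho_ge0 x y))
  (le_trans (rho_n_le rho_le x y n0) aK) K0.
rewrite (bigD1 k)//= (@le_trans _ _ (f k y))//; last first.
  by rewrite leeDl// sume_ge0.
rewrite /f indicE mem_set// mule1 lee_fin ler_expR.
by rewrite ler_wnM2l// mulr_ge0_le0.
Qed.

(** The upper half of the theorem of Varadhan, for a nonincreasing linear exponent.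
    With [K] cells of width [M / K], each term of [exp_moment_le] is at most
    [exp(n (eps / 2 - c))], and the factor [K] is absorbed by
    [exp(n eps / 2)]. *)
Lemma exp_moment_ldp (lam c eps : R) :
  (0 < M)%R -> (lam <= 0)%R -> (0 < eps)%R ->
  (forall z, (c + lam * z)%:E <= I z) ->
  {ae process_law X, forall x : path_space A, \forall n \near \oo,
    \int[block_law Y n]_y (expR (n%:R * lam * rho_n rho (first_n n x) y))%:E
    <= (expR (n%:R * (eps - c)))%:E}.
Proof.
move=> M0 lam0 eps0 line.
(* makes the variation of the exponent over one cell at most [eps / 4] *)
pose K := (Num.truncn (4 * `|lam| * M / eps)).+1.
have K0 : (0 < K%:R :> R)%R by rewrite ltr0n.
have lamK : (`|lam| * (M / K%:R) <= eps / 4)%R.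
  rewrite mulrA ler_pdivrMr//.
  have := truncnS_gt (4 * `|lam| * M / eps).
  rewrite -/K ltr_pdivrMr//; lra.
pose a (k : nat) := (k%:R * (M / K%:R))%R.
have levels : {ae process_law X, forall x : path_space A, forall k : 'I_K,
    \forall n \near \oo,
      (c + lam * a k.+1 - eps / 4)%:E <= ball_rate x (a k.+1) n}.
  apply: filter_forall => k; apply: filterS (ball_rate_ldp (a k.+1)) => x [+ _].
  apply; apply: (@lt_le_trans _ _ (c + lam * a k.+1)%:E).
    by rewrite lte_fin; lra.
  apply: le_ereal_inf_tmp => _ /= [z za <-]; apply: le_trans (line z).
  by rewrite lee_fin lerD2l ler_wnM2l.
apply: filterS levels => x /filter_forall h.
have hK : \forall n \near \oo, (ln K%:R <= n%:R * (eps / 2) :> R)%R.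
  apply: filterS (nbhs_infty_ger (ln K%:R / (eps / 2))) => n.
  by rewrite ler_pdivrMr// divr_gt0.
near=> n.
have n0 : (0 < n)%N by near: n; exists 1%N.
apply: (le_trans (@exp_moment_le n _ (first_n n x) lam K a n0 isT lam0 _ _)).
- by rewrite /a mul0r.
- by rewrite /a mulrC divfK// gt_eqF.
apply: (@le_trans _ _ (\sum_(k < K) (expR (n%:R * (eps / 2 - c)))%:E)).
  apply: lee_sum => k _.
  apply: (@le_trans _ _ ((expR (n%:R * lam * a k))%:E *
      (expR (n%:R * - (c + lam * a k.+1 - eps / 4)))%:E)).
    rewrite lee_wpmul2l ?lee_fin ?expR_ge0//.
    apply: le_ball_mass => //; move: k; near: n; exact: h.
  rewrite -EFinM -expRD lee_fin ler_expR -mulrA -mulrDr ler_wpM2l//.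
  have -> : a k.+1 = (a k + M / K%:R)%R by rewrite /a -natr1; ring.
  by move: lamK; rewrite ler0_norm//; lra.
rewrite sumEFin lee_fin sumr_const card_ord -[leLHS]mulr_natl.
rewrite -{1}(@lnK _ K%:R) ?posrE// -expRD ler_expR.
have : (ln K%:R <= n%:R * (eps / 2) :> R)%R by near: n.
by lra.
Unshelve. all: by end_near.
Qed.

Lemma probability_block n (G : set (n.-tuple A)) :
  block_law X n G = process_law X (@first_n _ A n @^-1` G).
Proof. by []. Qed.

Lemma measurable_first_n_preimage n (G : set (n.-tuple A)) : measurable G ->
  measurable (@first_n _ A n @^-1` G).
Proof.
by move=> mG; rewrite -[X in measurable X]setTI; apply: measurable_first_n.
Qed.

(** The good blocks [G n] of [R_n_ge] are those that satisfy the bound of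
    [exp_moment_ldp]; their probability tends to [1]. *)
Lemma R_n_near_ge (lam c eps D : R) :
  (0 < M)%R -> (lam <= 0)%R -> (0 < eps)%R ->
  (forall z, (c + lam * z)%:E <= I z) ->
  \forall n \near \oo,
    (c + lam * D - eps)%:E <= R_n rho (block_law X n) (block_law Y n) D.
Proof.
move=> M0 lam0 eps0 line.
have e20 : (0 < eps / 2)%R by rewrite divr_gt0.
pose b := (eps / 2 - c)%R.
pose G n := [set x : n.-tuple A |
  \int[block_law Y n]_y (expR (n%:R * lam * rho_n rho x y))%:E
  <= (expR (n%:R * b))%:E].
have mG n : measurable (G n).
  rewrite -[G n]setTI; apply: measurable_fun_lee => //.
  apply: (@measurable_fun_fubini_tonelli_F _ _ _ _ _ (block_law Y n)
    (fun z : n.-tuple A * n.-tuple B =>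
       (expR (n%:R * lam * rho_n rho z.1 z.2))%:E)).
    apply/measurable_EFinP; apply: measurableT_comp => //.
    by apply: measurable_funM => //; exact: measurable_rho_n.
  by move=> z; rewrite lee_fin expR_ge0.
have e1 : (0 < eps / 2 / (`|b| + 1))%R by rewrite divr_gt0// ltr_wpDl.
have mnG n : measurable (@first_n _ A n @^-1` (~` G n)).
  have mGc : measurable (~` G n) by apply: measurableC; exact: mG.
  exact: (measurable_first_n_preimage mGc).
have nG0 : \forall n \near \oo, process_law X (@first_n _ A n @^-1` (~` G n))
    <= (eps / 2 / (`|b| + 1))%:E.
  apply: measure_eventually_le => //.
  apply: filterS (exp_moment_ldp M0 lam0 e20 line) => x; apply: filterS => n Gn.
  by apply.
near=> n.
have n0 : (0 < n)%N by near: n; exists 1%N.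
apply: le_trans _ (@R_n_ge _ _ _ _ _ rho M rho_ge0 rho_le rho_meas n n0
  (block_law X n) (block_law Y n) lam b D (G n) lam0 (mG n) (fun x Gx => Gx)).
have PGE : fine (block_law X n (G n)) =
    (1 - fine (process_law X (@first_n _ A n @^-1` (~` G n))))%R.
  have mS := measurable_first_n_preimage (mG n).
  rewrite -preimage_setC (probability_setC _ mS) fineB ?fin_num_measure//.
  by rewrite probability_block/= opprB addrC subrK.
have p0 : (0 <= fine (process_law X (@first_n _ A n @^-1` (~` G n))))%R.
  by rewrite fine_ge0.
have : (fine (process_law X (@first_n _ A n @^-1` (~` G n)))
    <= eps / 2 / (`|b| + 1))%R.
  rewrite -lee_fin fineK; first by near: n.
  by rewrite fin_num_measure.
rewrite PGE lee_fin; set p := fine _ in p0 *.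
rewrite ler_pdivlMr ?ltr_wpDl// => pb.
have : (`|b * p| <= p * (`|b| + 1))%R by rewrite normrM (ger0_norm p0); lra.
rewrite ler_norml => /andP[h1 h2].
rewrite /b in h1 h2 *; lra.
Unshelve. all: by end_near.
Qed.

(** A radius [a] between [z] and [D] leaves room for the distortion of the rare
    blocks whose ball has mass less than [exp(-n c)]. *)
Lemma R_n_near_le (z c D : R) : (0 < D)%R -> (z < D)%R -> (0 <= c)%R ->
  I z < c%:E ->
  \forall n \near \oo, R_n rho (block_law X n) (block_law Y n) D <= c%:E.
Proof.
move=> D0 zD c0 Izc.
(* nonnegative, as [R_n_le] requires, even when [z] is very negative *)
pose a := Num.max 0%R ((z + D) / 2)%R.
have a0 : (0 <= a)%R by rewrite le_max lexx.
have za : (z < a)%R by rewrite lt_max; apply/orP; right; lra.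
have aD : (a < D)%R by rewrite gt_max D0/=; lra.
pose bad n := [set x : n.-tuple A |
  block_law Y n (distortion_ball rho x a) < (expR (n%:R * - c))%:E].
have mbad n : measurable (bad n).
  rewrite -[bad n]setTI; apply: measurable_fun_lte => //.
  exact: (@measurable_ball_mass _ _ _ _ _ _ rho_meas _ _ (cst a)).
have e1 : (0 < (D - a) / (`|M| + 1))%R by rewrite divr_gt0 ?subr_gt0// ltr_wpDl.
have bad0 : \forall n \near \oo, process_law X (@first_n _ A n @^-1` bad n)
    <= ((D - a) / (`|M| + 1))%:E.
  apply: measure_eventually_le => //.
    by move=> n; exact: measurable_first_n_preimage.
  apply: filterS (ball_rate_ldp a) => x [_ /(_ z c za Izc) rate].
  near=> n => badx.
  have n0 : (0 < n)%N by near: n; exists 1%N.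
  have raten : ball_rate x a n <= c%:E by near: n.
  by have := le_lt_trans (ge_ball_mass n0 raten) badx; rewrite ltxx.
near=> n.
have n0 : (0 < n)%N by near: n; exists 1%N.
have -> : c = (n%:R^-1 * - ln (expR (n%:R * - c)))%R.
  by rewrite expRK (mulrN n%:R) opprK mulKf// pnatr_eq0 -lt0n.
apply: (@R_n_le _ _ _ _ _ rho M rho_ge0 rho_le rho_meas n n0
  _ _ _ _ (cst a)) => //.
  by rewrite expR_gt0/= expR_le1 mulrN oppr_le0 mulr_ge0.
have badn : block_law X n (bad n) <= ((D - a) / (`|M| + 1))%:E by near: n.
have -> : \int[block_law X n]_x (cst a x)%:E = a%:E.
  rewrite -[RHS]mule1 -(@probability_setT _ _ _ (block_law X n)).
  by rewrite -integral_cst.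
have Mbad : M%:E * block_law X n (bad n) <= (D - a)%:E.
  by apply: lee_mul_small; rewrite ?subr_gt0.
apply: (le_trans (leeD2l _ Mbad)).
by rewrite -EFinD lee_fin; lra.
Unshelve. all: by end_near.
Qed.

Hypotheses (I_ge0 : forall z, 0 <= I z) (I_convex : econvex I).
Hypothesis M_gt0 : (0 < M)%R.

Lemma R_n_near_ge_lower_rate (D c : R) :
  rate_regular I D -> c%:E < lower_rate I D ->
  \forall n \near \oo, c%:E <= R_n rho (block_law X n) (block_law Y n) D.
Proof.
move=> regD cl; have [c' cc' c'l] := lt_between cl.
have [lam lam0 line] := supporting_line I_ge0 I_convex regD c'l.
have e0 : (0 < c' - c)%R by rewrite subr_gt0.
have line' z : (c' - lam * D + lam * z)%:E <= I z.
  by apply: le_trans (line z); rewrite lee_fin; lra.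
apply: filterS (R_n_near_ge D M_gt0 lam0 e0 line') => n.
by apply: le_trans; rewrite lee_fin; lra.
Qed.

Lemma R_n_cvg (D : R) : (0 < D)%R -> rate_regular I D ->
  R_n rho (block_law X n) (block_law Y n) D @[n --> \oo] --> lower_rate I D.
Proof.
move=> D0 regD; apply: cvge_between => c lc.
  exact: R_n_near_ge_lower_rate.
have [z zD Izc] := lower_rate_left I_ge0 I_convex regD lc.
apply: (R_n_near_le D0 zD _ Izc).
by rewrite -lee_fin (le_trans (I_ge0 z))// ltW.
Qed.

Lemma ball_rate_cvg (D : R) : rate_regular I D ->
  {ae process_law X, forall x : path_space A,
    ball_rate x D n @[n --> \oo] --> lower_rate I D}.
Proof.
move=> regD; apply: filterS (ball_rate_ldp D) => x [lo up].
apply: cvge_between => // c /(lower_rate_left I_ge0 I_convex regD)[z zD Izc].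
exact: up zD Izc.
Qed.

(** If [D] is not regular, the rate is infinite below [D] and finite at points
    arbitrarily close to [D] from above.  Hence the [R_n] tend to infinity at
    every level below [D] and are bounded at every level above [D], for small
    [n] by [R_n_lty]. *)
Lemma rate_regular_or_D_min_infty (D : R) : D_min rho X Y < D%:E ->
  (0 < D)%R /\ (rate_regular I D \/ D%:E = D_min_infty rho X Y).
Proof.
move=> DminD.
have Dmin_n n : (0 < n)%N -> D_min_n rho X Y n < D%:E.
  by move=> n0; apply: le_lt_trans DminD; apply: ereal_sup_ubound; exists n.
have D0 : (0 < D)%R.
  rewrite -lte_fin; apply: le_lt_trans (Dmin_n 1%N isT).
  apply: integral_ge0 => x _; apply: ess_inf_gee.
    by rewrite [ltRHS](@probability_setT _ _ _ (block_law Y 1)).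
  by apply: aeW => y; rewrite lee_fin; exact: rho_n_ge0.
split => //; have [|irrD] := pselect (rate_regular I D); [by left|right].
have infL z : (z < D)%R -> I z = +oo.
  move=> zD; apply: contrapT => /eqP Iz; apply: irrD; left; exists z => //.
  by rewrite ltey.
have finR D' : (D < D')%R -> exists2 z, (z < D')%R & I z < +oo.
  move=> DD'; apply: contrapT => nz; apply: irrD; right.
  exists ((D + D') / 2)%R; first lra.
  move=> z zD'; apply: contrapT => /eqP Iz; apply: nz.
  by exists z; [lra|rewrite ltey].
apply/eqP; rewrite eq_le; apply/andP; split.
  apply: le_ereal_inf_tmp => _ /= [D' [D'0 supR] <-]; rewrite lee_fin leNgt.
  apply/negP => D'D.
  have DD'2 : (D' < (D' + D) / 2 < D)%R by apply/andP; split; lra.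
  have {DD'2} [Dl lD] := andP DD'2.
  have IoD' z : (z <= (D' + D) / 2)%R -> I z = +oo.
    by move=> zl; apply: infL; exact: le_lt_trans lD.
  have regD' : rate_regular I D' by right; exists ((D' + D) / 2)%R.
  have lD' : lower_rate I D' = +oo.
    apply/eqP; rewrite -leye_eq; apply: le_ereal_inf_tmp => _ /= [z zD' <-].
    by rewrite IoD'// (le_trans zD')// ltW.
  move: supR; set S := ereal_sup _ => supR.
  have [c Sc] : exists c : R, S < c%:E.
    case: S supR => [r _|//|_]; last by exists 0%R; rewrite ltNyr.
    by exists (r + 1)%R; rewrite lte_fin ltrDl.
  have cD' : c%:E < lower_rate I D' by rewrite lD' ltry.
  have [N _ cR] := R_n_near_ge_lower_rate regD' cD'.
  have := le_lt_trans (cR N.+1 (leqnSn _)) _.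
  move=> /(_ c%:E) H; suff : c%:E < c%:E by rewrite ltxx.
  apply: H; apply: le_lt_trans Sc; apply: ereal_sup_ubound.
  by exists N.+1.
rewrite leNgt; apply/negP => /lt_between[D' DD']; apply/negP; rewrite -leNgt.
apply: ereal_inf_lbound; exists D' => //.
split; first by rewrite ltW// (lt_trans D0).
have [z zD' Iz] := finR D' DD'.
have Ifin : I z = (fine (I z))%:E by rewrite fineK// ge0_fin_numE.
apply: (@ereal_sup_lty _ _ (fine (I z) + 1)%R) => [n n0|].
  apply: (@R_n_lty _ _ _ _ _ rho M) => //.
  by apply: lt_trans (Dmin_n n n0) _; rewrite lte_fin.
apply: (R_n_near_le (lt_trans D0 DD') zD').
  by rewrite addr_ge0// fine_ge0.
by rewrite Ifin lte_fin ltrDl.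
Qed.

End conditional_ldp.
End random_balls.

Lemma ae_trajectory d1 (A : measurableType d1) d (Omega : measurableType d)
    (R : realType) (Pr : probability Omega R) (X : nat -> {RV Pr >-> A})
    (P : set (path_space A)) :
  {ae process_law X, forall x, P x} -> {ae Pr, forall w, P (trajectory X w)}.
Proof.
move=> [N [mN XN subN]]; exists (trajectory X @^-1` N); split.
- by rewrite -[X in measurable X]setTI; apply: measurable_trajectory.
- exact: XN.
- by move=> w; exact: subN.
Qed.

Theorem theorem4 (R : realType) (A Ahat : completeMetricType R)
    (sepA : separable A) (sepAhat : separable Ahat)
    (d : measure_display) (Omega : measurableType d)
    (Pr : probability Omega R)
    (X : nat -> {RV Pr >-> borel_algebra A})
    (Y : nat -> {RV Pr >-> borel_algebra Ahat})
    (statX : stationary X) (statY : stationary Y)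
    (indepXY : independent_processes X Y)
    (rho : borel_algebra A -> borel_algebra Ahat -> R)
    (rho_ge0 : forall x y, (0 <= rho x y)%R)
    (rho_meas : measurable_fun [set: borel_algebra A * borel_algebra Ahat]
       (fun z : borel_algebra A * borel_algebra Ahat => rho z.1 z.2))
    (rho_bounded : exists M : R, forall x y, (rho x y <= M)%R)
    (DminDav : D_min rho X Y < D_av rho X Y)
    (kappa : R.-pker (path_space (borel_algebra A)) ~>
                     (path_space (borel_algebra Ahat)))
    (kappaXY : conditional_law X Y kappa)
    (ldp : exists2 I : R -> \bar R, econvex I &
       {ae process_law X, forall x : path_space (borel_algebra A),
         LDP (kappa x)
           (fun n (y : path_space (borel_algebra Ahat)) =>
              rho_n rho (first_n n x) (first_n n y))
           I}) :
  forall D : R, D_min rho X Y < D%:E -> D%:E < D_av rho X Y ->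
    D%:E <> D_min_infty rho X Y ->
    cvgn (fun n => R_n rho (block_law X n) (block_law Y n) D) /\
    {ae Pr, forall w : Omega,
      (fun n => - (n%:R^-1%:E *
         lne (block_law Y n (distortion_ball rho (block X n w) D))))
        @ \oo --> R_rate rho X Y D}.
Proof.
move=> D DminD _ Dinf; have [I I_convex aeLDP] := ldp.
have [_ [I_ge0 _ _]] := ae_exists aeLDP.
have [M0 rhoM0] := rho_bounded.
pose M : R := (`|M0| + 1)%R.
have M_gt0 : (0 < M)%R by rewrite ltr_wpDl.
have rho_le x y : (rho x y <= M)%R.
  by rewrite (le_trans (rhoM0 x y))// (le_trans (ler_norm _))// lerDl.
have [D0 [regD|//]] := rate_regular_or_D_min_infty rho_ge0 rho_le rho_meas
  indepXY kappaXY aeLDP I_ge0 I_convex M_gt0 DminD.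
have cvR := R_n_cvg rho_ge0 rho_le rho_meas indepXY kappaXY aeLDP I_ge0 I_convex
  M_gt0 D0 regD.
have RE : R_rate rho X Y D = lower_rate I D by exact: cvg_lim cvR.
split; first by apply/cvg_ex; exists (lower_rate I D).
rewrite RE; apply: filterS (ae_trajectory (ball_rate_cvg rho_meas indepXY
  kappaXY aeLDP I_ge0 I_convex regD)) => w.
exact.
Qed.
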